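(* Let $X$ be a compact metric space containing more than one point, and let $Q:X\to(0,\infty)$ be a bounded function. If $\nu$ is an Ahlfors $Q$-regular Borel measure on $X$, then $Q=\alpha$ (that is, $Q(x)=\alpha(x)$ for all $x\in X$, where $\alpha$ is the local Hausdorff dimension) and $\nu\asymp H_{\mathrm{loc}}$, where $H_{\mathrm{loc}}$ is the local Hausdorff measure.
   Context: Let $(X,d)$ be a metric space, $B_r(x)$ the open ball of radius $r$ about $x$, and $|A|=\operatorname{diam}(A)$ for $A\subset X$. Variable Ahlfors regularity: for a bounded function $Q:X\to(0,\infty)$, a Borel measure $\nu$ on $X$ is (variable) Ahlfors $Q$-regular if there is a constant $C>1$ such that $\frac1C\nu(B_r(x))\le r^{Q(x)}\le C\nu(B_r(x))$ for all $x\in X$ and all $0<r\le\operatorname{diam}(X)$. Hausdorff dimension and local dimension: $\dim(A)$ denotes the Hausdorff dimension of $A\subset X$ (with values in $[0,\infty]$ for nonempty $A$, and $\dim(\emptyset)=-\infty$). The local (Hausdorff) dimension is $\alpha:X\to[0,\infty]$, $\alpha(x)=\inf\{\dim(U): U \text{ an open neighborhood of } x\}$. Local Hausdorff measure: for $\tau$ defined on all subsets of $X$ with values in $[0,\infty]$ and $\tau(\emptyset)=0$, let $\mu^*_{\tau,\delta}(A)=\inf\{\sum_{U\in\mathscr U}\tau(U)\}$, the infimum over at most countable families $\mathscr U$ of subsets of $X$ covering $A$ with $|U|\le\delta$ for all $U\in\mathscr U$, and $\mu^*_\tau(A)=\sup_{\delta>0}\mu^*_{\tau,\delta}(A)$;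 this is a metric outer measure, and $\mu_\tau$ denotes its restriction to the Borel sets. $H_{\mathrm{loc}}:=\mu_\tau$ for $\tau(U)=|U|^{\dim(U)}$ if $U\ne\emptyset$, $\tau(\emptyset)=0$, with the convention $|U|^0=1$ when $U\neq\emptyset$ and $|U|=0$. Strong equivalence: Borel measures satisfy $\mu\asymp\nu$ if there is $C>0$ with $\frac1C\nu(E)\le\mu(E)\le C\nu(E)$ for every Borel set $E$. *)

(* Defs.v *)
From HB Require Import structures.
From mathcomp Require Import all_boot all_order all_algebra.
From mathcomp Require Import all_classical all_reals all_analysis.

Set Implicit Arguments.
Unset Strict Implicit.
Unset Printing Implicit Defensive.

Import Order.TTheory GRing.Theory Num.Theory.
Import numFieldNormedType.Exports.

Local Open Scope classical_set_scope.
Local Open Scope ring_scope.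
Local Open Scope ereal_scope.

(* The base point is only there because measurable types are pointed in the
   library; it carries no information beyond nonemptiness. *)
#[short(type="pMetricType")]
HB.structure Definition PointedMetric (K : numDomainType) :=
  {T of Pointed T & Metric K T}.

(* The library's [ball x r] is the open ball, by [ballEmdist]. *)

Notation borel_type X := (g_sigma_algebraType (@open X)).

Section local_hausdorff.
Context {R : realType} {X : metricType R}.
Implicit Types (A U : set X) (F : set (set X)) (tau : set X -> \bar R).

(* [maxe 0] only matters for the empty set, whose diameter is thus 0 instead
   of the supremum [-oo] of the empty set. *)
Definition diam A : \bar R :=
  maxe 0 (ereal_sup [set (mdist p.1 p.2)%:E | p in A `*` A]).

Definition small_cover (delta : R) A : set (set (set X)) :=
  [set F | [/\ countable F, A `<=` \bigcup_(U in F) U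
             & forall U, F U -> diam U <= delta%:E]].

Definition mu_star_delta tau (delta : R) A : \bar R :=
  ereal_inf [set (\esum_(U in F) tau U)%R | F in small_cover delta A].

Definition mu_star tau A : \bar R :=
  ereal_sup [set mu_star_delta tau delta A | delta in [set d : R | (0 < d)%R]].

(* [x `^ s] for an extended exponent. The library's [poweR] satisfies
   [poweR x 0 = 1] for all [x], including [x = 0]. An infinite exponent is read
   as the limit [s --> +oo]; the value at [-oo] (the dimension of the empty set)
   is junk, as the empty set is treated separately below. *)
Definition epoweR (x s : \bar R) : \bar R :=
  match s with
  | r%:E => poweR x r
  | +oo => if x < 1 then 0 else if x == 1 then 1 else +oo
  | -oo => 0
  end.

Definition hausdorff_gauge (s : R) U : \bar R :=
  if U == set0 then 0 else poweR (diam U) s.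

Definition hausdorff_measure (s : R) : set X -> \bar R :=
  mu_star (hausdorff_gauge s).

Definition hausdorff_dim A : \bar R :=
  if A == set0 then -oo
  else ereal_inf [set s%:E | s in
         [set s : R | (0 <= s)%R /\ hausdorff_measure s A = 0]].

Definition local_dim (x : X) : \bar R :=
  ereal_inf [set hausdorff_dim U | U in open_nbhs x].

Definition local_hausdorff_gauge U : \bar R :=
  if U == set0 then 0 else epoweR (diam U) (hausdorff_dim U).

(* Given on all subsets; only its values on Borel sets are used. *)
Definition local_hausdorff_measure : set X -> \bar R :=
  mu_star local_hausdorff_gauge.

End local_hausdorff.

Definition ahlfors_regular {R : realType} {X : pMetricType R} (Q : X -> R)
    (nu : {measure set (borel_type X) -> \bar R}) : Prop :=
  exists2 C : R, (1 < C)%R &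
    forall (x : X) (r : R), (0 < r)%R -> r%:E <= diam [set: X] ->
      C^-1%:E * nu (ball x r) <= (r `^ Q x)%:E /\
      (r `^ Q x)%:E <= C%:E * nu (ball x r).

Definition strongly_equivalent {R : realType} {X : pMetricType R}
    (mu nu : set X -> \bar R) : Prop :=
  exists2 C : R, (0 < C)%R &
    forall E : set X, (@open X).-sigma.-measurable E ->
      C^-1%:E * nu E <= mu E /\ mu E <= C%:E * nu E.

(* Main.v *)
Require Import Defs.
From HB Require Import structures.
From mathcomp Require Import all_boot all_order all_algebra.
From mathcomp Require Import finmap lra.
From mathcomp Require Import all_classical all_reals all_analysis.

Set Implicit Arguments.
Unset Strict Implicit.
Unset Printing Implicit Defensive.

Import Order.TTheory GRing.Theory Num.Theory.
Import numFieldNormedType.Exports.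

Local Open Scope classical_set_scope.
Local Open Scope ring_scope.

(** Comparing nu on B(x, r) and on the larger ball B(y, 2 r), for points x, y at
    distance at most r, shows that r^Q(x) <= K r^Q(y) with a constant K
    ([powR_holder]). Equivalently Q varies by at most ln K / |ln r| at distance
    r ([log_holder]): Q is continuous, and replacing Q(x) by any number between
    the infimum and the supremum of Q on a small set U containing x changes the
    power |U|^Q(x) by a bounded factor only.

    Two estimates relate nu to measures built from gauges. If the gauge of every
    small U is at least a multiple of |U|^Q(x) for x in U, then nu is at most a
    multiple of the resulting outer measure, because U lies in a ball about x of
    radius 2 |U| ([nu_le_mu_star]). If the gauge of small balls is at most a
    multiple of r^Q(x), then the outer measure of an open set is at most a
    multiple of its nu-measure, because the set is covered by the enlargements
    of disjoint balls contained in it ([mu_star_delta_le_nu]).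

    Applied to the gauges |U|^s, these estimates bound the Hausdorff dimension
    of a set: it is at most every upper bound of Q on the set
    ([hausdorff_dim_le]), and at least every lower bound of Q on a nonempty open
    subset ([hausdorff_dim_ge]). With the continuity of Q, this gives
    Q = alpha ([local_dim_eq]).

    The local gauge |U|^dim(U) satisfies both hypotheses as well. For arbitrary
    small U one has dim(U) <= sup of Q on U, so the gauge is at least a multiple
    of |U|^Q(x) ([powR_le_local_gauge]); for balls also dim(U) >= inf of Q on U,
    so the gauge is at most a multiple of r^Q(x) ([local_gauge_mball_le]). Hence
    nu <= c H_loc on Borel sets and H_loc <= c nu on open sets. The latter
    inequality passes to Borel sets since nu, which is finite by compactness,
    is outer regular ([borel_outer_regular]). *)

(** * Sums of measures over countable and disjoint families *)

Section measure_covers.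
Local Open Scope ereal_scope.
Context (d : measure_display) (R : realType) (T : measurableType d).
Variable mu : {measure set T -> \bar R}.

Lemma measure_le_esum_cover (I : choiceType) (D : set I) (W : I -> set T)
    (A : set T) :
  countable D -> (forall i, D i -> measurable (W i)) -> measurable A ->
  A `<=` \bigcup_(i in D) W i -> mu A <= \esum_(i in D) mu (W i).
Proof.
move=> /countable_injP[f finj] mW mA AW.
pose G n := \bigcup_(i in D `&` f @^-1` [set n]) W i.
have GE i : D i -> G (f i) = W i.
  move=> Di; apply/seteqP; split=> [x [j [Dj /= fji]]|x Wx]; last by exists i.
  by have -> : j = i by apply: finj; rewrite ?inE.
have mG n : measurable (G n).
  have [[i Di <-]|nD] := pselect (exists2 i, D i & f i = n).
    by rewrite GE//; exact: mW.
  rewrite [G n](_ : _ = set0); first exact: measurable0.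
  by rewrite -subset0 => x [i [Di /= fi]] _; apply: nD; exists i.
have AG : A `<=` \bigcup_n G n.
  by move=> x /AW[i Di Wix]; exists (f i) => //; rewrite GE.
have /le_trans := measure_sigma_subadditive mu mG mA AG; apply.
rewrite nneseries_esumT; last by move=> n.
rewrite (_ : \esum_(i in D) mu (W i) = \esum_(i in D) mu (G (f i))); last first.
  by apply: eq_esum => i Di; rewrite GE.
rewrite -(@esum_image _ _ _ D f (fun n => mu (G n)) finj).
rewrite [leRHS]esum_mkcond; apply: le_esum => n _.
case: ifPn => // nD.
rewrite (_ : G n = set0) ?measure0// -subset0 => x [i [Di /= fi]] _.
by move/negP: nD; apply; rewrite inE; exists i.
Qed.

Lemma esum_measure_disjoint_le (I : choiceType) (D : set I) (W : I -> set T)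
    (B : set T) :
  trivIset D W -> (forall i, D i -> measurable (W i)) -> measurable B ->
  (forall i, D i -> W i `<=` B) -> \esum_(i in D) mu (W i) <= mu B.
Proof.
move=> tW mW mB WB; apply: ge_ereal_sup => _ [F [finF FD] <-].
rewrite -measure_fin_bigcup//; last 2 first.
- exact: sub_trivIset tW.
- by move=> i /FD; exact: mW.
apply: le_measure; rewrite ?inE//.
- by apply: fin_bigcup_measurable => // i /FD; exact: mW.
- by move=> x [i /FD Di]; exact: WB.
Qed.

(** For each n, only finitely many disjoint sets of measure at least
    1 / (n + 1) fit into a space of finite mass. *)
Lemma countable_disjoint_pos (I : choiceType) (D : set I) (W : I -> set T) :
  mu setT < +oo -> trivIset D W -> (forall i, D i -> measurable (W i)) ->
  (forall i, D i -> 0 < mu (W i)) -> countable D.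
Proof.
move=> muT tW mW W0.
pose D_ n := D `&` [set i | n.+1%:R^-1%:E <= mu (W i)].
have DE : D = \bigcup_n D_ n.
  apply/seteqP; split=> [i Di|i [n _ []]//].
  have muWi : mu (W i) \is a fin_num.
    rewrite ge0_fin_numE//; apply: le_lt_trans muT.
    by apply: le_measure; rewrite ?inE//; exact: mW.
  have := W0 _ Di; rewrite -(fineK muWi) lte_fin => wi0.
  have [n nw] := ltr_add_invr wi0.
  exists n => //; split => //=; rewrite -(fineK muWi) lee_fin.
  by rewrite add0r in nw; exact: ltW.
rewrite DE; apply: bigcup_countable => // n _; apply: finite_set_countable.
apply: contrapT => infD.
have [r r0 muTr] : exists2 r : R, (0 <= r)%R & mu setT = r%:E.
  exists (fine (mu setT)); first by rewrite fine_ge0.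
  by rewrite fineK// ge0_fin_numE.
pose N := (Num.truncn (r * n.+1%:R)).+1.
(* More than mu(T) (n + 1) sets of measure at least 1 / (n + 1) are too many. *)
have [B BD NB] := infinite_set_fset N infD.
have : \esum_(i in D) mu (W i) <= mu setT.
  exact: esum_measure_disjoint_le.
apply/negP; rewrite -ltNge muTr.
have sumB : \sum_(i <- B) mu (W i) <= \esum_(i in D) mu (W i).
  apply: ereal_sup_ubound; exists [set` B].
    by split => //; apply: subset_trans BD _ => i [].
  by rewrite fsbig_finite//= set_fsetK.
apply: lt_le_trans sumB.
have sumB : \sum_(i <- B) (n.+1%:R^-1)%:E <= \sum_(i <- B) mu (W i).
  by rewrite big_seq [leRHS]big_seq; apply: lee_sum => i /BD[].
apply: lt_le_trans sumB.
rewrite sumEFin lte_fin big_const_seq count_predT iter_addr addr0.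
rewrite -[ltRHS]mulr_natl.
rewrite ltr_pdivlMr//; apply: lt_le_trans (truncnS_gt _) _.
by rewrite ler_nat.
Qed.

End measure_covers.

(** * Balls and diameters *)

Section metric_facts.
Context (R : realType) (X : metricType R).
Implicit Types (x y z : X) (A B U : set X) (r c : R).

Lemma open_mball x r : open (ball x r).
Proof.
rewrite openE => y; rewrite ballEmdist/= => xy.
apply/nbhs_ballP; exists (r - mdist x y); first by rewrite /= subr_gt0.
move=> z; rewrite /= !ballEmdist/= => yz.
by rewrite (le_lt_trans (metric_triangle x y z))// -ltrBrDl.
Qed.

Lemma subset_mball x y r r' :
  mdist y x + r <= r' -> ball x r `<=` ball y r'.
Proof.
move=> rr' z; rewrite !ballEmdist/= => xz.
by rewrite (le_lt_trans (metric_triangle y x z))// (lt_le_trans _ rr')// ltrD2l.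
Qed.

Lemma mball_center x r : 0 < r -> ball x r x.
Proof. by move=> r0; rewrite ballEmdist/= mdistxx. Qed.

Lemma diam_ge0 A : (0 <= diam A)%E.
Proof. by rewrite /diam le_max lexx. Qed.

Lemma mdist_le_diam A x y : A x -> A y -> ((mdist x y)%:E <= diam A)%E.
Proof.
move=> Ax Ay; rewrite /diam le_max; apply/orP; right.
by apply: ereal_sup_ubound; exists (x, y).
Qed.

Lemma diam_le A c : 0 <= c -> (forall x y, A x -> A y -> mdist x y <= c) ->
  (diam A <= c%:E)%E.
Proof.
move=> c0 Ac; rewrite /diam ge_max lee_fin c0/=.
by apply: ge_ereal_sup => _ [[x y] [/= Ax Ay] <-]; rewrite lee_fin Ac.
Qed.

Lemma diam_mball_le x r : 0 <= r -> (diam (ball x r) <= (2 * r)%:E)%E.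
Proof.
move=> r0; apply: diam_le => [|y z]; first by rewrite mulr_ge0.
rewrite !ballEmdist/= => xy xz.
rewrite (le_trans (metric_triangle y x z))// metric_sym.
by rewrite mulr2n mulrDl !mul1r lerD// ltW.
Qed.

Lemma diam_fin A (d : R) : (diam A <= d%:E)%E ->
  exists2 r, (0 <= r <= d) & diam A = r%:E.
Proof.
move: (diam_ge0 A); case: (diam A) => [r||]//; rewrite !lee_fin => r0 rd.
by exists r => //; rewrite r0.
Qed.

End metric_facts.

(** * Outer measures built from gauges of small sets *)

Section caratheodory_construction.
Context (R : realType) (X : metricType R).
Implicit Types (A B U : set X) (tau : set X -> \bar R).

Lemma mu_starS tau A B : A `<=` B ->
  (mu_star tau A <= mu_star tau B)%E.
Proof.
move=> AB; apply: ge_ereal_sup => _ [d d0 <-].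
apply: (@le_trans _ _ (mu_star_delta tau d B)); last first.
  by apply: ereal_sup_ubound; exists d.
apply: ereal_inf_le_tmp => _ [F [cF BF dF] <-]; exists F => //.
by split => //; exact: subset_trans BF.
Qed.

Lemma le_mu_star tau A (c : \bar R) (d : R) :
  0 < d -> (c <= mu_star_delta tau d A)%E -> (c <= mu_star tau A)%E.
Proof.
by move=> d0 /le_trans; apply; apply: ereal_sup_ubound; exists d.
Qed.

(** The pre-measures increase as delta decreases, so only small delta
    matter. *)
Lemma mu_star_le tau A (c : \bar R) (d0 : R) : 0 < d0 ->
  (forall d : R, (0 < d <= d0)%R -> mu_star_delta tau d A <= c)%E ->
  (mu_star tau A <= c)%E.
Proof.
move=> d00 h; apply: ge_ereal_sup => _ [d/= dgt0 <-].
have m0 : 0 < Num.min d d0 by rewrite lt_min dgt0.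
have md0 : 0 < Num.min d d0 <= d0 by rewrite m0 ge_min lexx orbT.
apply: le_trans (h _ md0).
apply: ereal_inf_le_tmp => _ [F [cF BF dF] <-]; exists F => //.
split => // U FU; apply: (le_trans (dF U FU)).
by rewrite lee_fin ge_min lexx.
Qed.

(** Families of sets are unindexed in the definition of the pre-measures, so an
    indexed cover in which a set occurs twice is counted with smaller sum; the
    proof passes to a set of indices on which the family is injective. *)
Lemma mu_star_delta_le_esum tau (d : R) A
    (I : choiceType) (S : set I) (f : I -> set X) :
  (forall U, 0 <= tau U)%E ->
  countable S -> A `<=` \bigcup_(i in S) f i ->
  (forall i, S i -> diam (f i) <= d%:E)%E ->
  (mu_star_delta tau d A <= \esum_(i in S) tau (f i))%E.
Proof.
move=> tau0 cS AS dS.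
apply: (@le_trans _ _ (\esum_(U in f @` S) tau U)).
  apply: ereal_inf_lbound; exists (f @` S) => //; split.
  - exact: sub_countable (card_image_le _ _) cS.
  - by move=> x /AS[i Si fx]; exists (f i) => //; exists i.
  - by move=> _ [i Si <-]; exact: dS.
have [nS|/existsNP[i0 _]] := pselect (forall i, ~ S i).
  rewrite (_ : f @` S = set0) ?esum_set0 ?esum_ge0//.
  by rewrite -subset0 => t [i Si _]; exact: (nS i).
have /choice[g gP] : forall U, exists i, (f @` S) U -> S i /\ f i = U.
  move=> U; have [[i Si <-]|nU] := pselect ((f @` S) U); first by exists i.
  by exists i0.
have gI : set_inj (f @` S) g.
  move=> U V /set_mem /gP fU /set_mem /gP fV gUV.
  by rewrite -fU.2 -fV.2 gUV.
rewrite (_ : \esum_(U in f @` S) tau U = \esum_(U in f @` S) tau (f (g U)))%E.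
  rewrite -(@esum_image _ _ _ _ g (fun i => tau (f i)) gI).
  rewrite esum_mkcond [leRHS]esum_mkcond; apply: le_esum => i _.
  case: ifPn => [/set_mem[U fSU <-]|_]; last by case: ifPn.
  by rewrite mem_set//; have [] := gP _ fSU.
by apply: eq_esum => U /gP[_ ->].
Qed.

Lemma mu_star_ge0 tau (A : set X) :
  (forall U, 0 <= tau U)%E -> (0 <= mu_star tau A)%E.
Proof.
move=> tau0; apply: (@le_mu_star tau A _ 1) => //.
by apply: le_ereal_inf_tmp => _ [F _ <-]; apply: esum_ge0.
Qed.

Lemma hausdorff_gauge_ge0 (s : R) (U : set X) : (0 <= hausdorff_gauge s U)%E.
Proof. by rewrite /hausdorff_gauge; case: ifPn => // _; exact: poweR_ge0. Qed.

Lemma hausdorff_gaugeE (s r : R) (U : set X) : U !=set0 -> diam U = r%:E ->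
  hausdorff_gauge s U = (r `^ s)%:E.
Proof. by move=> /set0P/negbTE U0 Ur; rewrite /hausdorff_gauge U0 Ur. Qed.

Lemma hausdorff_dim_ge0 (U : set X) : U !=set0 -> (0 <= hausdorff_dim U)%E.
Proof.
move=> /set0P/negbTE U0; rewrite /hausdorff_dim U0.
by apply: le_ereal_inf_tmp => _ [s [s0 _] <-]; rewrite lee_fin.
Qed.

Lemma epoweR_ge0 (x s : \bar R) : (0 <= epoweR x s)%E.
Proof.
case: s => [s||]//=; first exact: poweR_ge0.
by case: ifPn => // _; case: ifPn.
Qed.

Lemma local_hausdorff_gauge_ge0 (U : set X) : (0 <= local_hausdorff_gauge U)%E.
Proof.
by rewrite /local_hausdorff_gauge; case: ifPn => // _; exact: epoweR_ge0.
Qed.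

End caratheodory_construction.

(** * Packings by balls of varying radius *)

Section packing.
Context (R : realType) (X : metricType R).

Lemma open_ball_sub (U : set X) (x : X) : open U -> U x ->
  exists2 r : R, 0 < r & ball x r `<=` U.
Proof. by move=> oU Ux; apply/nbhs_ballP; exact: open_nbhs_nbhs. Qed.

(** The covering lemma of Vitali for radii that vary slowly. A maximal disjoint
    subfamily of the balls B(x, rho x) meets every other ball B(y, rho y), and
    then d(x, y) < rho x + rho y <= 2 rho x + d(x, y) / 4, whence
    d(x, y) < 3 rho x. The Lipschitz condition replaces the usual selection of
    balls by decreasing size. *)
Lemma packing_cover (A : set X) (rho : X -> R) :
  (forall x, A x -> 0 < rho x) ->
  (forall x y, A x -> A y -> rho y <= rho x + mdist x y / 4) ->
  exists S : set X, [/\ S `<=` A, trivIset S (fun x => ball x (rho x)) &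
    A `<=` \bigcup_(x in S) ball x (3 * rho x)].
Proof.
move=> rho0 rhoL.
have [S [SA tS maxS]] :=
  ex_maximal_disjoint_subcollection (fun x => ball x (rho x)) A.
exists S; split => // y Ay.
have [Sy|nSy] := pselect (S y).
  exists y => //; apply: mball_center.
  by rewrite mulr_gt0// rho0.
have SyA : S `|` [set y] `<=` A by move=> z [/SA//|->].
have SSy : S `<` S `|` [set y].
  by split; [exact: subsetUl | move=> /(_ y (or_intror erefl))].
have [x Sx [z []]] : exists2 x, S x & ball x (rho x) `&` ball y (rho y) !=set0.
  apply: contrapT => nS; apply: (maxS _ SSy SyA).
  move=> u v [Su|->] [Sv|->]//.
  - exact: tS.
  - by move=> uy; exfalso; apply: nS; exists u.
  - by move=> vy; exfalso; apply: nS; exists v => //; rewrite setIC.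
rewrite !ballEmdist/= => xz yz; exists x => //.
have := rhoL x y (SA _ Sx) Ay.
have := metric_triangle x z y; rewrite (metric_sym z y) ballEmdist/=.
by have := rho0 x (SA _ Sx); lra.
Qed.

(** One quarter of the distance to the complement of O, truncated at d. The
    distance is written as the supremum of the radii of the balls inside O,
    which also makes sense when O is the whole space. *)
Lemma lipschitz_radius (O : set X) (d : R) : open O -> 0 < d ->
  exists rho : X -> R,
    (forall x, O x -> [/\ 0 < rho x, rho x <= d & ball x (rho x) `<=` O]) /\
    (forall x y, rho y <= rho x + mdist x y / 4).
Proof.
move=> oO d0.
pose D x := [set r : R | 0 <= r <= d /\ ball x r `<=` O].
have D0 x : D x 0.
  by split=> [|y]; rewrite ?lexx ?ltW// ballEmdist/= ltNge mdist_ge0.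
have supD x : has_sup (D x).
  by split; [exists 0 | exists d => r [/andP[]]].
exists (fun x => sup (D x) / 4); split.
  move=> x Ox.
  have [r r0 rO] := open_ball_sub oO Ox.
  have s0 : 0 < sup (D x).
    have m0 : 0 < Num.min r d by rewrite lt_min r0.
    apply: (lt_le_trans m0); apply: sup_ubound; first exact: (supD x).2.
    split; first by rewrite ltW//= ge_min lexx orbT.
    apply: subset_trans rO; apply: subset_mball.
    by rewrite mdistxx add0r ge_min lexx.
  split.
  - by rewrite divr_gt0.
  - have : sup (D x) <= d by apply: ge_sup => [|r' [/andP[]]//]; exists 0.
    by move: s0; lra.
  - have : sup (D x) / 4 < sup (D x) by move: s0; lra.
    move=> s4 z zx.
    have [r' [_ rO'] rs] := sup_gt (ex_intro _ 0 (D0 x)) s4.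
    by apply: rO'; apply: le_ball zx; exact: ltW.
move=> x y.
suff : sup (D y) <= sup (D x) + mdist x y by lra.
apply: ge_sup; first by exists 0.
move=> r [/andP[r0 rd] rO].
rewrite -lerBlDr; have [rxy|rxy] := leP r (mdist x y).
  rewrite (@le_trans _ _ 0)// ?subr_le0//.
  by apply: sup_ubound; [exact: (supD x).2|].
apply: sup_ubound; first exact: (supD x).2.
split.
  rewrite subr_ge0 (ltW rxy)/= lerBlDr (le_trans rd)// lerDl.
  exact: mdist_ge0.
apply: subset_trans rO; apply: subset_mball.
by rewrite metric_sym; lra.
Qed.

End packing.

(** * Outer regularity of finite Borel measures on metric spaces *)

Lemma nonincreasing_measure_lt d (R : realType) (T : measurableType d)
    (mu : {measure set T -> \bar R}) (F : (set T)^nat) (c : \bar R) :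
  (mu (F 0%N) < +oo)%E -> (forall n, measurable (F n)) ->
  (forall n, F n.+1 `<=` F n) -> (mu (\bigcap_n F n) < c)%E ->
  exists n, (mu (F n) <= c)%E.
Proof.
move=> F0 mF FS Fc; apply: contrapT => /forallNP nF.
have FD n m : (n <= m)%N -> F m `<=` F n.
  elim: m => [|m ih]; first by rewrite leqn0 => /eqP ->.
  by rewrite leq_eqVlt => /predU1P[->//|/ih]; exact: subset_trans.
have muF : mu (F n) @[n --> \oo] --> mu (\bigcap_n F n).
  apply: nonincreasing_cvg_mu => //; first exact: bigcapT_measurable.
  by move=> n m nm; apply/subsetPset; exact: FD.
move: Fc; apply/negP; rewrite -leNgt; apply: (cvge_to_ge muF).
by apply: nearW => n; rewrite leNgt; apply/negP => /ltW; exact: nF.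
Qed.

Section regularity.
Context (R : realType) (X : pMetricType R).
Variable nu : {measure set (borel_type X) -> \bar R}.

(** E lies between the closed set ~` V' and the open set V, and V `&` V' is the
    difference of these two. Keeping V' instead of its complement makes the
    notion visibly invariant under complementation. *)
Let approx (E : set X) := forall e : R, 0 < e -> exists V V' : set X,
  [/\ open V, open V', E `<=` V, ~` E `<=` V' & (nu (V `&` V') <= e%:E)%E].

Lemma open_measurable_borel (V : set X) : open V ->
  measurable (V : set (borel_type X)).
Proof. by move=> oV; apply: sub_gen_smallest. Qed.

Lemma measurable_mball (x : X) (r : R) :
  measurable (ball x r : set (borel_type X)).
Proof. by apply: open_measurable_borel; exact: open_mball. Qed.

Lemma measurable_point (x : X) : measurable ([set x] : set (borel_type X)).
Proof.
rewrite -[X in measurable X]setCK; apply: measurableC.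
apply: open_measurable_borel; apply: closed_openC.
apply: (accessible_finite_set_closed.1 (hausdorff_accessible _)) => //.
exact: metric_hausdorff.
Qed.

Hypothesis nu_fin : (nu setT < +oo)%E.

Lemma nu_lty (E : set X) : measurable (E : set (borel_type X)) ->
  (nu E < +oo)%E.
Proof.
move=> mE; apply: le_lt_trans nu_fin; apply: le_measure; rewrite ?inE//.
Qed.

(** The closed sets exhausting U consist of the points at distance at least
    1 / (n + 1) from the complement. *)
Lemma approx_open (U : set X) : open U -> approx U.
Proof.
move=> oU e e0.
pose V' n := \bigcup_(z in ~` U) ball z n.+1%:R^-1.
have oV' n : open (V' n) by apply: bigcup_open => z _; exact: open_mball.
pose F n : set (borel_type X) := U `&` V' n.
have mF n : measurable (F n).
  by apply: open_measurable_borel; apply: openI.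
have F0 : \bigcap_n F n = set0.
  rewrite -subset0 => x Fx; have [Ux _] := Fx 0%N Logic.I.
  have [r r0 rU] := open_ball_sub oU Ux.
  have [n] := ltr_add_invr r0; rewrite add0r => nr.
  have [_ [z nUz zx]] := Fx n Logic.I; apply: nUz; apply: rU.
  by apply: ball_sym; apply: le_ball zx; exact: ltW.
have [||||n Fn] := @nonincreasing_measure_lt _ _ _ nu F e%:E.
- exact: nu_lty.
- by [].
- move=> n; apply: setIS => x [z nUz zx].
  exists z => //; apply: le_ball zx.
  by rewrite lef_pV2 ?posrE// ler_nat.
- by rewrite F0 measure0 lte_fin.
exists U, (V' n); split => // x nUx; exists x => //.
by apply: mball_center; rewrite invr_gt0.
Qed.

Lemma approxC (E : set X) : approx E -> approx (~` E).
Proof.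
move=> aE e /aE[V [V' [oV oV' EV EV' VV']]]; exists V', V; split => //.
- by rewrite setCK.
- by rewrite setIC.
Qed.

(** The union of the closed approximations need not be closed, so only finitely
    many of them are kept, which is enough by continuity from above. *)
Lemma approx_bigcup (E : (set X)^nat) : (forall n, approx (E n)) ->
  approx (\bigcup_n E n).
Proof.
move=> aE e e0.
have e20 : 0 < e / 2 by rewrite divr_gt0.
have /choice[VV VVP] : forall n, exists VV : set X * set X,
    [/\ open VV.1, open VV.2, E n `<=` VV.1, ~` E n `<=` VV.2 &
      (nu (VV.1 `&` VV.2) <= (e / 2 / (2 ^ n.+1)%:R)%:E)%E].
  move=> n; have [|V [V' ?]] := aE n (e / 2 / (2 ^ n.+1)%:R).
    by rewrite divr_gt0// ltr0n expn_gt0.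
  by exists (V, V').
pose V := \bigcup_n (VV n).1.
(* P n is the complement of the union of the first n closed approximations. *)
pose fix P (n : nat) : set X := if n is m.+1 then P m `&` (VV m).2 else setT.
have oV : open V by apply: bigcup_open => n _; have [] := VVP n.
have oP n : open (P n).
  elim: n => [|n ih]; first exact: openT.
  by apply: openI => //; have [] := VVP n.
have PE n : ~` (\bigcup_n E n) `<=` P n.
  elim: n => [//|n ih] x nEx; split; first exact: ih.
  by have [_ _ _ h _] := VVP n; apply: h => Enx; apply: nEx; exists n.
pose F n : set (borel_type X) := V `&` P n.
pose W n : set (borel_type X) := (VV n).1 `&` (VV n).2.
have mF n : measurable (F n).
  by apply: open_measurable_borel; exact: openI.
have mW n : measurable (W n).
  by apply: open_measurable_borel; have [? ? _ _ _] := VVP n; exact: openI.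
have FW : \bigcap_n F n `<=` \bigcup_n W n.
  move=> x Fx; have [[n _ Vn] _] := Fx 0%N Logic.I.
  by exists n => //; split => //; have [_ []] := Fx n.+1 Logic.I.
have [||||n Fn] := @nonincreasing_measure_lt _ _ _ nu F e%:E.
- exact: nu_lty.
- by [].
- by move=> n; apply: setIS => x [].
- have mFI := bigcapT_measurable mF.
  have /le_lt_trans := measure_sigma_subadditive nu mW mFI FW; apply.
  apply: (@le_lt_trans _ _ (e / 2)%:E); last first.
    by rewrite lte_fin ltr_pdivrMr// ltr_pMr// ltr1n.
  have := @epsilon_trick R (fun=> 0%E) (e / 2) xpredT (fun=> lexx _) (ltW e20).
  rewrite [X in (_ <= X + _)%E]eseries0// add0e; apply: le_trans.
  by apply: lee_nneseries => // n _; rewrite add0e; have [_ _ _ _] := VVP n.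
exists V, (P n); split => // x [m _ Em]; exists m => //.
by have [_ _ h _ _] := VVP m; exact: h.
Qed.

Lemma borel_approx (E : set X) : measurable (E : set (borel_type X)) ->
  approx E.
Proof.
move=> mE; apply: (mE approx); split; last by move=> U; exact: approx_open.
split.
- by apply: approx_open; exact: open0.
- by move=> A aA; rewrite setTD; exact: approxC.
- exact: approx_bigcup.
Qed.

Lemma borel_outer_regular (E : set X) (e : R) :
  measurable (E : set (borel_type X)) -> 0 < e ->
  exists V : set X, [/\ open V, E `<=` V & (nu V <= nu E + e%:E)%E].
Proof.
move=> mE e0; have [V [V' [oV oV' EV EV' VV']]] := borel_approx mE e0.
exists V; split => //.
have mV := open_measurable_borel oV.
have mVV' := open_measurable_borel (openI oV oV').
have : (nu (E `|` (V `&` V')) <= nu E + nu (V `&` V'))%E by exact: measureU2.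
move=> h; apply: (@le_trans _ _ (nu E + nu (V `&` V'))%E); last exact: leeD2l.
apply: le_trans h; apply: le_measure; rewrite ?inE//; first exact: measurableU.
move=> x Vx; have [|nEx] := pselect (E x); first by left.
by right; split => //; exact: EV'.
Qed.

End regularity.

(** * Perturbing exponents by a multiple of 1 / |ln r| *)

Section real_powers.
Context (R : realType).
Implicit Types (r a b : R).

Lemma powR_le_anti r a b : 0 < r < 1 -> r `^ a <= r `^ b -> b <= a.
Proof.
move=> /andP[r0 r1] h.
have lnr : ln r < 0 by rewrite ln_lt0// r0.
have : ln (r `^ a) <= ln (r `^ b) by rewrite ler_ln// posrE powR_gt0.
by rewrite !ln_powR ler_nM2r.
Qed.

(** The change of exponent that multiplies a power of r by K; it tends to 0
    with r. *)
Definition log_shift (K r : R) := ln K / - ln r.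

Lemma powR_log_shift K r a : 0 < K -> 0 < r < 1 ->
  r `^ (a - log_shift K r) = K * r `^ a.
Proof.
move=> K0 /andP[r0 r1].
have lnr : ln r < 0 by rewrite ln_lt0// r0.
have r_neq0 : r != 0 by rewrite gt_eqF.
rewrite powRB ?r_neq0 ?implybT// mulrC; congr (_ * _).
apply: ln_inj; rewrite ?posrE ?invr_gt0 ?powR_gt0//.
rewrite lnV ?posrE ?powR_gt0// ln_powR /log_shift.
by rewrite invrN mulrN mulNr opprK divfK// lt_eqF.
Qed.

Lemma log_shift_small K e c : 0 < e -> 0 < c ->
  exists r, [/\ 0 < r < 1, r <= c & log_shift K r <= e].
Proof.
move=> e0 c0; pose r := Num.min (Num.min c 2^-1) (expR (- (ln K / e))).
have r0 : 0 < r by rewrite !lt_min c0 expR_gt0 invr_gt0 ltr0n.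
have r1 : r < 1 by rewrite !gt_min invf_lt1// ltr1n orbT.
have lnr : ln r < 0 by rewrite ln_lt0// r0.
exists r; split; first by rewrite r0.
  by rewrite !ge_min lexx.
rewrite /log_shift ler_pdivrMr ?oppr_gt0// -ler_pdivrMl// mulrC lerNr.
rewrite -[leRHS]expRK ler_ln ?posrE ?expR_gt0//.
by rewrite !ge_min lexx orbT.
Qed.

Lemma powR_small a e c : 0 < a -> 0 < e -> 0 < c ->
  exists r, [/\ 0 < r, r <= c & r `^ a <= e].
Proof.
move=> a0 e0 c0; exists (Num.min c (e `^ a^-1)); split.
- by rewrite lt_min c0 powR_gt0.
- by rewrite ge_min lexx.
rewrite -[leRHS](powRr1 (ltW e0)) -(@mulVf _ a) ?gt_eqF// powRrM.
apply: ge0_ler_powR; rewrite ?nnegrE ?le_min ?powR_ge0 ?(ltW a0) ?(ltW c0)//.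
by rewrite ge_min lexx orbT.
Qed.

Lemma epoweR_le r d m (s : \bar R) : 0 <= d <= r -> 0 < r < 1 ->
  (0 <= s -> m%:E <= s -> epoweR d%:E s <= (r `^ m)%:E)%E.
Proof.
move=> /andP[d0 dr] /andP[r0 r1]; case: s => [s||]//=.
- rewrite !lee_fin => s0 ms; apply: (@le_trans _ _ (r `^ s)).
    by apply: ge0_ler_powR => //; rewrite ?nnegrE// ltW.
  by apply: ger_powR => //; rewrite r0 ltW.
- by rewrite lte_fin (le_lt_trans dr r1) lee_fin powR_ge0.
Qed.

Lemma le_epoweR r M (s : \bar R) : 0 < r < 1 ->
  (0 <= s -> s <= M%:E -> (r `^ M)%:E <= epoweR r%:E s)%E.
Proof.
move=> /andP[r0 r1]; case: s => [s||]//=.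
by rewrite !lee_fin => s0 sM; apply: ger_powR => //; rewrite r0 ltW.
Qed.

End real_powers.

(** * Consequences of variable Ahlfors regularity *)

Section ahlfors.
Context (R : realType) (X : pMetricType R) (Q : X -> R).
Context (nu : {measure set (borel_type X) -> \bar R}).
(** The regularity estimates are kept up to one positive real radius rmax
    instead of the diameter, which is an extended real. *)
Context (B C rmax : R).
Hypothesis Q_gt0 : forall x, 0 < Q x.
Hypothesis Q_le : forall x, Q x <= B.
Hypothesis C_gt1 : 1 < C.
Hypothesis rmax_gt0 : 0 < rmax.
Hypothesis nu_reg : forall (x : X) (r : R), 0 < r -> r <= rmax ->
  (C^-1%:E * nu (ball x r) <= (r `^ Q x)%:E)%E /\
  ((r `^ Q x)%:E <= C%:E * nu (ball x r))%E.

Let C_gt0 : 0 < C. Proof. by rewrite (lt_trans _ C_gt1). Qed.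

Lemma nu_mball_le (x : X) (r : R) : 0 < r -> r <= rmax ->
  (nu (ball x r) <= (C * r `^ Q x)%:E)%E.
Proof.
move=> r0 rD; have [+ _] := nu_reg x r0 rD.
by rewrite lee_pdivrMl// EFinM.
Qed.

Lemma nu_mball_gt0 (x : X) (r : R) : 0 < r -> (0 < nu (ball x r))%E.
Proof.
move=> r0; pose s := Num.min r rmax.
have s0 : 0 < s by rewrite lt_min r0.
have sD : s <= rmax by rewrite ge_min lexx orbT.
have [_ h] := nu_reg x s0 sD.
apply: (@lt_le_trans _ _ (nu (ball x s))).
  rewrite lt_neqAle measure_ge0 andbT eq_sym; apply/eqP => nu0.
  by move: h; rewrite nu0 mule0 lee_fin leNgt powR_gt0.
apply: le_measure; rewrite ?inE; [exact: measurable_mball..|].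
by apply: le_ball; rewrite ge_min lexx.
Qed.

(** The constant in the comparison of the powers r^Q(x) and r^Q(y) at points of
    distance at most r: one factor C for each point, and 2^B for doubling the
    radius. *)
Definition holder_constant := C * C * 2 `^ B.

Lemma holder_constant_gt0 : 0 < holder_constant.
Proof. by rewrite !mulr_gt0 ?powR_gt0. Qed.
Let K := holder_constant.
Let K_gt0 : 0 < K := holder_constant_gt0.

(** The ball B(x, r) lies in B(y, 2 r). Comparing the measures of the two balls
    shows that r^Q(x) and r^Q(y) agree up to a constant. *)
Lemma powR_holder (x y : X) (r : R) :
  mdist x y <= r -> 0 < r -> 2 * r <= rmax ->
  r `^ Q x <= K * r `^ Q y.
Proof.
move=> xyr r0 rD.
have r20 : 0 < 2 * r by rewrite mulr_gt0.
have rD' : r <= rmax by move: rD r0; lra.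
rewrite -lee_fin; have [_ /le_trans] := nu_reg x r0 rD'; apply.
apply: (@le_trans _ _ (C%:E * nu (ball y (2 * r)))%E).
  rewrite lee_pmul2l//; apply: le_measure; rewrite ?inE.
  - exact: measurable_mball.
  - exact: measurable_mball.
  - by apply: subset_mball; rewrite metric_sym; move: xyr; lra.
apply: (@le_trans _ _ (C%:E * (C * (2 * r) `^ Q y)%:E)%E).
  by rewrite lee_pmul2l//; exact: nu_mball_le.
rewrite -EFinM lee_fin /K /holder_constant powRM ?(ltW r0)// -!mulrA.
rewrite ler_pM2l// ler_pM2l// ler_pM2r ?powR_gt0//.
by apply: ler_powR => //; rewrite ler1n.
Qed.

(** The comparison of powers, read on exponents: Q varies by at most
    ln K / |ln r| at distance r, that is, Q is log-Hoelder continuous. *)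
Lemma log_holder (x y : X) (r : R) : mdist x y <= r -> 0 < r < 1 ->
  2 * r <= rmax -> Q y - log_shift K r <= Q x.
Proof.
move=> xyr r01 rD; apply: (@powR_le_anti _ r) => //.
rewrite powR_log_shift//; apply: powR_holder => //.
by case/andP: r01.
Qed.

Lemma Q_near (x : X) (e : R) : 0 < e -> exists2 r, 0 < r &
  forall y, ball x r y -> Q x - e <= Q y <= Q x + e.
Proof.
move=> e0; have D20 : 0 < rmax / 2 by rewrite divr_gt0.
have [r [r01 rD re]] := log_shift_small K e0 D20.
have rD2 : 2 * r <= rmax by move: rD; lra.
exists r; first by case/andP: r01.
move=> y; rewrite ballEmdist/= => /ltW xyr.
have h1 := log_holder xyr r01 rD2.
rewrite metric_sym in xyr.
have h2 := log_holder xyr r01 rD2.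
by apply/andP; split; lra.
Qed.

(** Here positivity of Q enters: r^Q(x) tends to 0 with r. *)
Lemma nu_point (x : X) : nu [set x] = 0%E.
Proof.
apply/eqP; rewrite eq_le measure_ge0 andbT; apply/lee_addgt0Pr => e e0.
rewrite add0e; have eC : 0 < e / C by rewrite divr_gt0.
have [r [r0 rD re]] := powR_small (Q_gt0 x) eC rmax_gt0.
apply: (@le_trans _ _ (nu (ball x r))).
  apply: le_measure; rewrite ?inE;
    [exact: measurable_point|exact: measurable_mball|].
  by move=> _ ->; exact: mball_center.
apply: (le_trans (nu_mball_le x r0 rD)).
by rewrite lee_fin mulrC -ler_pdivlMr.
Qed.

(** The mass distribution principle. A set U of diameter r > 0 that meets E in
    x lies in B(x, 2 r), so that its intersection with E has mass at most a
    constant times r^Q(x), and the masses of the members of a cover add up to at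
    least that of E. A set of diameter 0 is a point and has no mass. The gauge
    is only compared with r^Q(x) at points x of E; this matters for
    [hausdorff_dim_ge], where Q is controlled on an open set only. *)
Lemma nu_le_mu_star (E : set X) (tau : set X -> \bar R) (k d : R) :
  measurable (E : set (borel_type X)) ->
  (forall U, 0 <= tau U)%E -> 0 < k -> 0 < d -> 2 * d <= rmax ->
  (forall (U : set X) x r, E x -> U x -> diam U = r%:E -> 0 < r <= d ->
    ((r `^ Q x)%:E <= k%:E * tau U)%E) ->
  (nu E <= (C * 2 `^ B * k)%:E * mu_star tau E)%E.
Proof.
move=> mE tau0 k0 d0 dD Utau.
set c := C * _ * _; have c0 : 0 < c by rewrite !mulr_gt0 ?powR_gt0.
rewrite -lee_pdivrMl//; apply: (@le_mu_star _ _ _ _ _ d) => //.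
apply: le_ereal_inf_tmp => _ [F [cF EF dF] <-].
have ci0 : 0 <= c^-1 by rewrite invr_ge0 ltW.
(* The constant is absorbed into the measure, to avoid scaling sums. *)
pose m : {measure set (borel_type X) -> \bar R} := mscale (NngNum ci0) nu.
have mscaleE A : m A = ((c^-1)%:E * nu A)%E by [].

have /choice[W WP] : forall U : set X, exists W : set (borel_type X), F U ->
    [/\ measurable W, E `&` U `<=` W & (m W <= tau U)%E].
  move=> U; have [FU|nFU] := pselect (F U); last by exists set0.
  have [[x [Ex Ux]]|nEU] := pselect (E `&` U !=set0); last first.
    exists set0 => _; split => //; last by rewrite measure0.
    by move=> x EUx; exfalso; apply: nEU; exists x.
  have [r /andP[r0 rd] Ur] := diam_fin (dF _ FU).
  have Usub y : U y -> mdist x y <= r.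
    by move=> Uy; rewrite -lee_fin -Ur; exact: mdist_le_diam.
  have [r_eq0|r_neq0] := eqVneq r 0.
    exists [set x] => _; split; first exact: measurable_point.
    - move=> y [_ Uy]; apply/esym/mdist_positivity/eqP.
      by rewrite eq_le mdist_ge0 andbT -r_eq0 Usub.
    - by rewrite mscaleE nu_point mule0.
  have rgt0 : 0 < r by rewrite lt_neqAle eq_sym r_neq0.
  exists (ball x (2 * r)) => _; split; first exact: measurable_mball.
  - by move=> y [_ /Usub xy]; rewrite ballEmdist/=; lra.
  - rewrite mscaleE lee_pdivrMl//.
    apply: (le_trans (nu_mball_le x _ _)); [by lra|by lra|].
    have := Utau U x r Ex Ux Ur; rewrite rgt0 rd => /(_ isT) h.
    have C2 : (0 <= (C * 2 `^ B)%:E)%E.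
      by rewrite lee_fin mulr_ge0 ?powR_ge0 ?(ltW C_gt0).
    rewrite /c (EFinM _ k) -muleA; apply: le_trans (lee_wpmul2l C2 h).
    rewrite -EFinM lee_fin powRM ?(ltW rgt0)// mulrA ler_wpM2r ?powR_ge0//.
    by rewrite ler_pM2l// ler_powR// ler1n.
apply: (@le_trans _ _ (\esum_(U in F) m (W U))).
  rewrite -mscaleE; apply: measure_le_esum_cover => //.
  - by move=> U /WP[].
  - move=> x Ex; have [U FU Ux] := EF _ Ex; exists U => //.
    by have [_ h _] := WP _ FU; apply: h.
by apply: le_esum => U /WP[].
Qed.

Hypothesis nu_fin : (nu setT < +oo)%E.

(** The converse of the mass distribution principle. The balls B(x, 3 rho x) of
    a maximal packing cover A, and the disjoint balls B(x, rho x), of measure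
    comparable to rho(x)^Q(x), have total mass at most nu(W). *)
Lemma mu_star_delta_le_nu (A W : set X) (rho : X -> R) (tau : set X -> \bar R)
    (k d : R) :
  measurable (W : set (borel_type X)) -> (forall U, 0 <= tau U)%E -> 0 <= k ->
  (forall x, A x -> [/\ 0 < rho x, rho x <= rmax, 6 * rho x <= d &
    ball x (rho x) `<=` W]) ->
  (forall x y, rho y <= rho x + mdist x y / 4) ->
  (forall x, A x -> (tau (ball x (3 * rho x)) <= (k * rho x `^ Q x)%:E)%E) ->
  (mu_star_delta tau d A <= (k * C)%:E * nu W)%E.
Proof.
move=> mW tau0 k0 rhoP rhoL tauA.
have [S [SA tS AS]] : exists S : set X, [/\ S `<=` A,
    trivIset S (fun x => ball x (rho x)) &
    A `<=` \bigcup_(x in S) ball x (3 * rho x)].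
  by apply: packing_cover => [x /rhoP[]//|x y _ _]; exact: rhoL.
have kC0 : 0 <= k * C by rewrite mulr_ge0// ltW.
pose m : {measure set (borel_type X) -> \bar R} := mscale (NngNum kC0) nu.
have mscaleE A' : m A' = ((k * C)%:E * nu A')%E by [].
have cS : countable S.
  apply: (countable_disjoint_pos nu_fin tS) => [x _|x /SA/rhoP[r0 _ _ _]].
    exact: measurable_mball.
  exact: nu_mball_gt0.
apply: (@le_trans _ _ (\esum_(x in S) tau (ball x (3 * rho x)))%E).
  apply: mu_star_delta_le_esum => // x /SA/rhoP[r0 _ rd _].
  by apply: (le_trans (diam_mball_le _ _)); rewrite ?lee_fin; lra.
apply: (@le_trans _ _ (\esum_(x in S) m (ball x (rho x)))%E).
  apply: le_esum => x /SA Ax; apply: (le_trans (tauA x Ax)).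
  have [r0 rD _ _] := rhoP _ Ax; rewrite mscaleE 2!EFinM -muleA.
  by apply: lee_wpmul2l; [rewrite lee_fin|have [] := nu_reg x r0 rD].
rewrite -mscaleE; apply: esum_measure_disjoint_le => //.
- by move=> x _; exact: measurable_mball.
- by move=> x /SA/rhoP[].
Qed.

(** If the s-dimensional measure of U vanished for some s < m, then r^Q(y) would
    be at most r^s for r <= 1 and y in V, and the mass distribution principle
    would give nu(V) = 0; but V contains a ball. *)
Lemma hausdorff_dim_ge (U V : set X) (m : R) : V `<=` U -> open V -> V !=set0 ->
  (forall y, V y -> m <= Q y) -> (m%:E <= hausdorff_dim U)%E.
Proof.
move=> VU oV [x Vx] mQ; rewrite /hausdorff_dim.
have U0 : U !=set0 by exists x; exact: VU.
rewrite (negbTE ((set0P U).2 U0)).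
apply: le_ereal_inf_tmp => _ [s [s0 HsU] <-]; rewrite lee_fin leNgt.
apply/negP => sm.
pose d := Num.min 1 (rmax / 2).
have d0 : 0 < d by rewrite lt_min ltr01 divr_gt0.
have dD : 2 * d <= rmax.
  by rewrite mulrC -ler_pdivlMr// ge_min lexx orbT.
have d1 : d <= 1 by rewrite ge_min lexx.
have : (nu V <= (C * 2 `^ B * 1)%:E * mu_star (hausdorff_gauge s) V)%E.
  apply: (@nu_le_mu_star V (hausdorff_gauge s) 1 d) => //.
  - exact: open_measurable_borel.
  - exact: hausdorff_gauge_ge0.
  move=> W y r Vy Wy Wr /andP[r0 rd]; rewrite mul1e.
  rewrite (hausdorff_gaugeE _ _ Wr); last by exists y.
  rewrite lee_fin; apply: ger_powR; first by rewrite r0 (le_trans rd).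
  exact: le_trans (ltW sm) (mQ _ Vy).
have Hs0 : (mu_star (hausdorff_gauge s) V <= 0)%E.
  by rewrite -HsU; exact: mu_starS.
apply/negP; rewrite -ltNge; apply: (@le_lt_trans _ _ 0%E).
  apply: mule_ge0_le0 => //.
  by rewrite lee_fin !mulr_ge0 ?powR_ge0 ?(ltW C_gt0).
have [r r0 rV] := open_ball_sub oV Vx.
apply: (lt_le_trans (nu_mball_gt0 x r0)).
by apply: le_measure; rewrite ?inE//;
  [exact: measurable_mball|exact: open_measurable_borel].
Qed.

(** Balls of one fixed radius r suffice: for s = M + e the gauge of such a ball
    is at most a constant times r^e r^Q(y), so that the pre-measure of U is
    at most a constant times r^e nu(X), which tends to 0 with r. *)
Lemma hausdorff_dim_le (U : set X) (M : R) : U !=set0 ->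
  (forall y, U y -> Q y <= M) -> (hausdorff_dim U <= M%:E)%E.
Proof.
move=> U0 QM; have [x Ux] := U0.
have M0 : 0 < M by exact: lt_le_trans (Q_gt0 x) (QM _ Ux).
apply/lee_addgt0Pr => e e0; rewrite -EFinD.
set s := M + e; have s0 : 0 < s by rewrite addr_gt0.
rewrite /hausdorff_dim (negbTE ((set0P U).2 U0)).
apply: ereal_inf_lbound; exists s => //; split; first exact: ltW.
apply/eqP; rewrite eq_le mu_star_ge0 ?andbT; last exact: hausdorff_gauge_ge0.
have [v v0 nuv] : exists2 v : R, 0 <= v & nu setT = v%:E.
  exists (fine (nu setT)); first by rewrite fine_ge0.
  by rewrite fineK// ge0_fin_numE.
apply/lee_addgt0Pr => eta eta0; rewrite add0e.
apply: (@mu_star_le _ _ _ _ _ 1) => // d /andP[d0 d1].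
have eta'0 : 0 < eta / (6 `^ s * C * (v + 1)).
  by rewrite divr_gt0// !mulr_gt0 ?powR_gt0// ltr_wpDl.
have dD0 : 0 < Num.min (d / 6) rmax by rewrite lt_min rmax_gt0 divr_gt0.
have [r [r0 rdD re]] := powR_small e0 eta'0 dD0.
have {rdD}[rd rD] : r <= d / 6 /\ r <= rmax.
  by move: rdD; rewrite le_min => /andP.
apply: (@le_trans _ _ ((6 `^ s * r `^ e * C)%:E * nu setT)%E).
  apply: (@mu_star_delta_le_nu U setT (fun=> r)) => //.
  - exact: hausdorff_gauge_ge0.
  - by rewrite mulr_ge0 ?powR_ge0.
  - by move=> y _; split => //; lra.
  - by move=> y z; rewrite lerDl divr_ge0// mdist_ge0.
  move=> y Uy.
  have r30 : 0 <= 3 * r by rewrite mulr_ge0// ltW.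
  have [r' /andP[r'0 r'r] Br'] := diam_fin (diam_mball_le y r30).
  rewrite (hausdorff_gaugeE _ _ Br'); last first.
    by exists y; apply: mball_center; lra.
  rewrite lee_fin; apply: (@le_trans _ _ ((6 * r) `^ s)).
    by apply: ge0_ler_powR; rewrite ?nnegrE ?(ltW s0)//; lra.
  rewrite powRM ?(ltW r0)// -mulrA ler_wpM2l ?powR_ge0//.
  rewrite /s addrC powRD ?(gt_eqF r0) ?implybT// ler_wpM2l ?powR_ge0//.
  by apply: ger_powR; [rewrite r0; lra|exact: QM].
rewrite nuv -EFinM lee_fin.
apply: (@le_trans _ _ (r `^ e * (6 `^ s * C * (v + 1)))).
  rewrite [6 `^ s * _]mulrC -!mulrA ler_wpM2l ?powR_ge0//.
  rewrite ler_wpM2l ?powR_ge0// ler_wpM2l ?(ltW C_gt0)//.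
  by rewrite lerDl.
by rewrite -ler_pdivlMr// !mulr_gt0 ?powR_gt0// ltr_wpDl.
Qed.

(** By continuity of Q, the dimension of every small neighbourhood of x is
    between Q(x) - e and Q(x) + e. *)
Lemma local_dim_eq (x : X) : (Q x)%:E = local_dim x.
Proof.
apply/eqP; rewrite eq_le; apply/andP; split.
  apply: le_ereal_inf_tmp => _ [U [oU Ux] <-].
  apply/lee_addgt0Pr => e e0; rewrite -leeBlDr//.
  have [r r0 rQ] := Q_near x e0; have [r' r'0 rU] := open_ball_sub oU Ux.
  apply: (@hausdorff_dim_ge _ (ball x (Num.min r r'))).
  - by apply: subset_trans rU; apply: le_ball; rewrite ge_min lexx orbT.
  - exact: open_mball.
  - by exists x; apply: mball_center; rewrite lt_min r0.
  move=> y xy; have /rQ/andP[] : ball x r y; last by [].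
  by apply: le_ball xy; rewrite ge_min lexx.
apply/lee_addgt0Pr => e e0; have [r r0 rQ] := Q_near x e0.
apply: (@le_trans _ _ (hausdorff_dim (ball x r))).
  apply: ereal_inf_lbound; exists (ball x r) => //.
  by split; [exact: open_mball|exact: mball_center].
apply: hausdorff_dim_le; first by exists x; exact: mball_center.
by move=> y /rQ/andP[].
Qed.

(** The exponent dim(U) exceeds Q(x) by at most the oscillation of Q on U, which
    is at most ln K / |ln r|; this changes the power by a factor K only. The set
    U is arbitrary here, and its dimension may be much smaller than Q(x). *)
Lemma powR_le_local_gauge (U : set X) (x : X) (r : R) : U x -> diam U = r%:E ->
  0 < r < 1 -> 2 * r <= rmax ->
  ((r `^ Q x)%:E <= K%:E * local_hausdorff_gauge U)%E.
Proof.
move=> Ux Ur r01 rD; have U0 : U !=set0 by exists x.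
rewrite /local_hausdorff_gauge (negbTE ((set0P U).2 U0)) Ur.
have : (hausdorff_dim U <= (Q x + log_shift K r)%:E)%E.
  apply: hausdorff_dim_le => // y Uy; rewrite -lerBlDr.
  by apply: log_holder => //; rewrite -lee_fin -Ur; exact: mdist_le_diam.
move=> /(le_epoweR r01 (hausdorff_dim_ge0 U0)) h.
apply: (@le_trans _ _ (K%:E * (r `^ (Q x + log_shift K r))%:E)%E).
  by rewrite -EFinM lee_fin -powR_log_shift// addrK.
by rewrite lee_pmul2l.
Qed.

(** For a ball the dimension is also bounded below, because the ball is open.
    Its diameter may be much smaller than its radius, which only decreases the
    gauge. *)
Lemma local_gauge_mball_le (x : X) (r : R) :
  0 < r -> 6 * r < 1 -> 12 * r <= rmax ->
  (local_hausdorff_gauge (ball x (3 * r)) <= (K * 6 `^ B * r `^ Q x)%:E)%E.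
Proof.
move=> r0 r1 rD; have r30 : 0 <= 3 * r by lra.
have U0 : ball x (3 * r) !=set0 by exists x; apply: mball_center; lra.
have [r' /andP[r'0 r'r] Br'] := diam_fin (diam_mball_le x r30).
rewrite /local_hausdorff_gauge (negbTE ((set0P _).2 U0)) Br'.
have r601 : 0 < 6 * r < 1 by apply/andP; split; lra.
apply: (@le_trans _ _ ((6 * r) `^ (Q x - log_shift K (6 * r)))%:E).
  apply: epoweR_le => //; first by apply/andP; split; lra.
    exact: hausdorff_dim_ge0.
  apply: (@hausdorff_dim_ge _ (ball x (3 * r))) => //; first exact: open_mball.
  move=> y; rewrite ballEmdist/= => xy; apply: log_holder => //; last by lra.
  by rewrite metric_sym; lra.
rewrite powR_log_shift// lee_fin -mulrA ler_pM2l// powRM ?(ltW r0)//.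
by rewrite ler_wpM2r ?powR_ge0// ler_powR// ler1n.
Qed.

(** The packing radius at x is proportional to the distance from x to the
    complement, so that all the disjoint balls stay inside the open set and the
    estimate involves its own measure. *)
Lemma local_hausdorff_open_le (O : set X) : open O ->
  (local_hausdorff_measure O <= (K * 6 `^ B * C)%:E * nu O)%E.
Proof.
move=> oO; apply: (@mu_star_le _ _ _ _ _ 1) => // d /andP[d0 d1].
have e0 : 0 < Num.min (d / 7) (rmax / 12) by rewrite lt_min !divr_gt0.
have [rho [rhoP rhoL]] := lipschitz_radius oO e0.
have rhoO x : O x -> [/\ 0 < rho x, rho x <= d / 7, rho x <= rmax / 12 &
    ball x (rho x) `<=` O].
  by move=> /rhoP[? + ?]; rewrite le_min => /andP[].
apply: (@mu_star_delta_le_nu O O rho) => //.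
- exact: open_measurable_borel.
- exact: local_hausdorff_gauge_ge0.
- by rewrite mulr_ge0 ?powR_ge0// ltW.
- by move=> x /rhoO[? ? ? ?]; split => //; lra.
- by move=> x /rhoO[? ? ? ?]; apply: local_gauge_mball_le; lra.
Qed.

Lemma local_hausdorff_le (E : set X) : measurable (E : set (borel_type X)) ->
  (local_hausdorff_measure E <= (K * 6 `^ B * C)%:E * nu E)%E.
Proof.
move=> mE; set c := K * _ * C.
have c0 : 0 < c by rewrite !mulr_gt0 ?powR_gt0.
apply/lee_addgt0Pr => e e0; have ec0 : 0 < e / c by rewrite divr_gt0.
have [V [oV EV nuV]] := borel_outer_regular nu_fin mE ec0.
apply: (le_trans (mu_starS _ EV)).
apply: (le_trans (local_hausdorff_open_le oV)).
apply: (@le_trans _ _ (c%:E * (nu E + (e / c)%:E))%E).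
  by rewrite lee_pmul2l.
rewrite ge0_muleDr ?lee_fin ?(ltW ec0)//.
by rewrite -EFinM mulrC divfK ?gt_eqF.
Qed.

Lemma nu_le_local_hausdorff (E : set X) : measurable (E : set (borel_type X)) ->
  (nu E <= (C * 2 `^ B * K)%:E * local_hausdorff_measure E)%E.
Proof.
move=> mE; pose d := Num.min 2^-1 (rmax / 2).
have d0 : 0 < d by rewrite lt_min divr_gt0// invr_gt0 ltr0n.
have /andP[d1 dD] : (d <= 2^-1) && (d <= rmax / 2) by rewrite -le_min.
apply: (@nu_le_mu_star _ _ _ d) => //; first exact: local_hausdorff_gauge_ge0.
  by lra.
move=> U x r Ex Ux Ur /andP[r0 rd]; apply: powR_le_local_gauge => //.
  by apply/andP; split => //; lra.
by lra.
Qed.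

End ahlfors.

(** * Compactness and conclusion *)

Lemma compact_measure_lty (R : realType) (X : pMetricType R)
    (nu : {measure set (borel_type X) -> \bar R}) (r : R) :
  compact [set: X] -> 0 < r -> (forall x, nu (ball x r) < +oo)%E ->
  (nu setT < +oo)%E.
Proof.
move=> cX r0 nur.
have [F _ XF] : finite_subset_cover setT (fun x : X => ball x r) setT.
  move: cX; rewrite compact_cover; apply.
  - by move=> x _; exact: open_mball.
  - by move=> x _; exists x => //; exact: mball_center.
have /le_lt_trans := @content_sub_fsum _ _ _ nu X [set` F] setT
  (fun x => ball x r) (finite_fset F) (fun x _ => measurable_mball x r)
  measurableT XF.
apply; rewrite fsbig_finite//=.
by apply: lte_sum_pinfty => x _; exact: nur.
Qed.

Theorem theorem3p6 (R : realType) (X : pMetricType R)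
    (X_compact : compact [set: X])
    (X_nontrivial : exists x y : X, x != y)
    (Q : X -> R)
    (Q_gt0 : forall x : X, 0 < Q x)
    (Q_bounded : has_ubound (range Q))
    (nu : {measure set (borel_type X) -> \bar R})
    (nu_regular : ahlfors_regular Q nu) :
  (forall x : X, (Q x)%:E = local_dim x) /\
  strongly_equivalent nu local_hausdorff_measure.
Proof.
have [B QB] := Q_bounded; have [C C1 nuC] := nu_regular.
have [a [b ab]] := X_nontrivial.
have Q_le x : Q x <= B by apply: QB; exists x.
(* Two distinct points give a positive real radius below the diameter. *)
pose D := mdist a b; have D0 : 0 < D by rewrite mdist_gt0.
have nu_reg (x : X) (r : R) : 0 < r -> r <= D ->
    (C^-1%:E * nu (ball x r) <= (r `^ Q x)%:E)%E /\
    ((r `^ Q x)%:E <= C%:E * nu (ball x r))%E.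
  move=> r0 rD; apply: nuC => //; apply: (@le_trans _ _ D%:E) => //.
  exact: mdist_le_diam.
have nu_fin : (nu setT < +oo)%E.
  apply: (@compact_measure_lty _ _ _ D) => // x.
  by apply: (le_lt_trans (nu_mball_le C1 nu_reg x D0 (lexx _))); rewrite ltry.
split; first by move=> x; exact: (local_dim_eq Q_gt0 Q_le C1 D0 nu_reg nu_fin).
pose K := holder_constant B C.
have C0 : 0 < C by exact: lt_trans C1.
have K0 : 0 < K by rewrite /K /holder_constant !mulr_gt0 ?powR_gt0.
pose c1 := K * 6 `^ B * C; pose c2 := C * 2 `^ B * K.
have c10 : 0 < c1 by rewrite !mulr_gt0 ?powR_gt0.
exists (Num.max c1 c2) => [|E mE]; first by rewrite lt_max c10.
split.
  rewrite lee_pdivrMl ?lt_max ?c10//.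
  apply: (le_trans (local_hausdorff_le Q_gt0 Q_le C1 D0 nu_reg nu_fin mE)).
  by apply: lee_wpmul2r; rewrite ?lee_fin ?le_max ?lexx.
apply: (le_trans (nu_le_local_hausdorff Q_gt0 Q_le C1 D0 nu_reg nu_fin mE)).
apply: lee_wpmul2r; last by rewrite lee_fin le_max lexx orbT.
by apply: mu_star_ge0; exact: local_hausdorff_gauge_ge0.
Qed.
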